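(* Let $\mathcal C$ be a finitely complete category and let $R$ be a Moore relation system on $\mathcal C$. Then the factorization $\mathbf F(R)$ is a type-theoretic weak factorization structure.
   Context: Conventions: finite limits are chosen; $(a,b)$ denotes the morphism into a product or pullback with components $a,b$; $A\,{}_{a}\!\times_{b}B$ is the pullback of $a:A\to Z$ and $b:B\to Z$. A relation $R$ on $\mathcal C$ consists, for each object $X$, of morphisms $\eta_X:X\to\Psi X$ and $\epsilon_{0X},\epsilon_{1X}:\Psi X\to X$ with $\epsilon_{iX}\eta_X=1_X$, and, for each $f:X\to Y$, of a chosen $\Psi f:\Psi X\to\Psi Y$ with $\epsilon_{iY}\Psi f=f\epsilon_{iX}$, $\Psi f\,\eta_X=\eta_Yf$ (functoriality not required). A factorization $F$ on $\mathcal C$ assigns to each $f:X\to Y$ morphisms $\lambda_Ff:X\to\Phi_Ff$, $\rho_Ff:\Phi_Ff\to Y$ with $\rho_Ff\,\lambda_Ff=f$, and to each commutative square $\langle\alpha,\beta\rangle:f\to g$ (so $g\alpha=\beta f$) a chosen $\Phi_F\langle\alpha,\beta\rangle:\Phi_Ff\to\Phi_Fg$ with $\Phi_F\langle\alpha,\beta\rangle\lambda_Ff=\lambda_Fg\,\alpha$, $\rho_Fg\,\Phi_F\langle\alpha,\beta\rangle=\beta\rho_Ff$ (functoriality not required). $\mathrm{coalg}(F)$ is the class of $f:X\to Y$ for which there is $s:Y\to\Phi_Ff$ with $sf=\lambda_Ff$, $\rho_Ff\,s=1_Y$; $\mathrm{alg}(F)$ is the class of $f:X\to Y$ for which there is $s:\Phi_Ff\to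 X$ with $s\lambda_Ff=1_X$, $fs=\rho_Ff$. $F$ is a weak factorization structure if $\lambda_Ff\in\mathrm{coalg}(F)$ and $\rho_Ff\in\mathrm{alg}(F)$ for all $f$; then $[F]=(\mathrm{coalg}(F),\mathrm{alg}(F))$ is a weak factorization system. A weak factorization system $(\mathsf L,\mathsf R)$ is type-theoretic if every morphism to a terminal object is in $\mathsf R$ and $\mathsf L$ is stable under pullback along $\mathsf R$; $F$ is type-theoretic if $[F]$ is. For a relation $R$, $\mathbf F(R)$ is the factorization sending $f:X\to Y$ to $X\xrightarrow{(1_X,\eta_Yf)}X\,{}_{f}\!\times_{\epsilon_0}\Psi Y\xrightarrow{\epsilon_1\pi_{\Psi Y}}Y$ and $\langle\alpha,\beta\rangle$ to $\alpha\times\Psi\beta$. A relation $R$ is a Moore relation system if it is transitive, homotopical and symmetric. Transitive: for each $X$ there is $\mu_X:\Psi X\,{}_{\epsilon_1}\!\times_{\epsilon_0}\Psi X\to\Psi X$ with $\epsilon_0\mu_X=\epsilon_0\pi_0$, $\epsilon_1\mu_X=\epsilon_1\pi_1$, $\mu_X(1,\eta\epsilon_1)=1_{\Psi X}$. Homotopical: for each $X$ there are an object $\Psi^{\square}X$ and morphisms $\eta^{\square}:X\to\Psi^{\square}X$, $\epsilon^{\square}_0,\epsilon^{\square}_1,\zeta:\Psi^{\square}X\to\Psi X$, $\delta_X:\Psi X\to\Psi^{\square}X$, and for each $f:X\to Y$ a morphism $\tau_f:X\,{}_{\eta f}\!\times_{\zeta}\Psi^{\square}Y\to\Psi(X\,{}_{f}\!\times_{\epsilon_0}\Psi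 Y)$, such that $\epsilon^{\square}_i\eta^{\square}=\eta$, $\zeta\eta^{\square}=\eta$, $\epsilon_0\epsilon^{\square}_i=\epsilon_i\zeta$, $\delta\eta=\eta^{\square}$, $\epsilon^{\square}_0\delta=\zeta\delta=\eta\epsilon_0$, $\epsilon^{\square}_1\delta=1_{\Psi X}$, $\tau_f(1_X,\eta^{\square}f)=\eta(1_X,\eta f)$, and $\epsilon_i\tau_f=1_X\times\epsilon^{\square}_i$ ($i=0,1$). Symmetric: for each $X$ there is $\nu_X:\Psi X\,{}_{\epsilon_0}\!\times_{\epsilon_0}\Psi X\to\Psi X$ with $\epsilon_0\nu_X=\epsilon_1\pi_0$, $\epsilon_1\nu_X=\epsilon_1\pi_1$, $\nu_X(\eta\epsilon_0,1)=1_{\Psi X}$. *)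

(* Defs.v *)
From Stdlib Require Import List.

Set Implicit Arguments.
Unset Strict Implicit.
Unset Printing Implicit Defensive.

Declare Scope cat_scope.
Delimit Scope cat_scope with cat.
Open Scope cat_scope.

Record category := Category {
  ob :> Type;
  hom : ob -> ob -> Type;
  idm : forall X, hom X X;
  comp : forall X Y Z, hom Y Z -> hom X Y -> hom X Z;
  compA : forall X Y Z W (h : hom Z W) (g : hom Y Z) (f : hom X Y),
    comp h (comp g f) = comp (comp h g) f;
  comp1m : forall X Y (f : hom X Y), comp (idm Y) f = f;
  compm1 : forall X Y (f : hom X Y), comp f (idm X) = f
}.

Arguments hom {c} X Y.
Arguments idm {c} X.
Arguments comp {c X Y Z} g f : rename.

Notation "g ∘ f" := (comp g f) (at level 40, left associativity) : cat_scope.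

Record functor (J C : category) := Functor {
  fob :> J -> C;
  fmap : forall i j, hom i j -> hom (fob i) (fob j);
  fmap_id : forall i, fmap (idm i) = idm (fob i);
  fmap_comp : forall i j k (v : hom j k) (u : hom i j),
    fmap (v ∘ u) = fmap v ∘ fmap u
}.

Definition is_cone (J C : category) (D : functor J C) (W : C)
    (c : forall i, hom W (D i)) : Prop :=
  forall i j (u : hom i j), fmap D u ∘ c i = c j.

Record limit (J C : category) (D : functor J C) := Limit {
  lim_ob : C;
  lim_proj : forall i, hom lim_ob (D i);
  lim_cone : is_cone lim_proj;
  lim_med : forall W (c : forall i, hom W (D i)), is_cone c -> hom W lim_ob;
  lim_medP : forall W (c : forall i, hom W (D i)) (cc : is_cone c) i,
    lim_proj i ∘ lim_med cc = c i;
  lim_uniq : forall W (u v : hom W lim_ob),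
    (forall i, lim_proj i ∘ u = lim_proj i ∘ v) -> u = v
}.

Definition finite_type (T : Type) : Prop := exists s : list T, forall x, In x s.

Definition finite_category (J : category) : Prop :=
  finite_type J /\ forall i j : J, finite_type (hom i j).

Record fc_category := FcCategory {
  fc_cat :> category;
  fc_lim : forall (J : category), finite_category J ->
    forall D : functor J fc_cat, limit D
}.

Definition is_terminal (C : category) (T : C) : Prop :=
  forall X : C, exists! f : hom X T, True.

Definition is_pullback (C : category) (A B Z P : C)
    (a : hom A Z) (b : hom B Z) (p : hom P A) (q : hom P B) : Prop :=
  a ∘ p = b ∘ q /\
  forall W (x : hom W A) (y : hom W B), a ∘ x = b ∘ y ->
    exists! u : hom W P, p ∘ u = x /\ q ∘ u = y.

Inductive cospan_ob : Set := csL | csM | csR.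

Definition cospan_hom (i j : cospan_ob) : Set :=
  match i, j with
  | csL, csL | csM, csM | csR, csR | csL, csM | csR, csM => unit
  | _, _ => Empty_set
  end.

Lemma cospan_hom_irr i j (u v : cospan_hom i j) : u = v.
Proof. destruct i, j, u, v; reflexivity. Qed.

Definition cospan_id (i : cospan_ob) : cospan_hom i i.
Proof. destruct i; exact tt. Defined.

Definition cospan_comp (i j k : cospan_ob) :
  cospan_hom j k -> cospan_hom i j -> cospan_hom i k.
Proof. destruct i, j, k; intros v u; first [exact tt | contradiction]. Defined.

Definition cospan : category.
Proof.
  refine (@Category cospan_ob cospan_hom cospan_id cospan_comp _ _ _);
    intros; apply cospan_hom_irr.
Defined.

Lemma cospan_finite : finite_category cospan.
Proof.
  split.
  - exists (csL :: csM :: csR :: nil); intros []; simpl; auto.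
  - intros i j; destruct i, j; simpl;
      first [ exists (tt :: nil); intros []; simpl; auto; fail
            | exists nil; intros [] ].
Qed.

Section Pullback.

Variable C : fc_category.

Section Cospan.

Variables (A B Z : C) (a : hom A Z) (b : hom B Z).

Definition cospan_fob (i : cospan) : C :=
  match i with csL => A | csM => Z | csR => B end.

Definition cospan_fmap (i j : cospan) :
    hom i j -> hom (cospan_fob i) (cospan_fob j) :=
  match i, j return cospan_hom i j -> hom (cospan_fob i) (cospan_fob j) with
  | csL, csL => fun _ => idm A
  | csM, csM => fun _ => idm Z
  | csR, csR => fun _ => idm B
  | csL, csM => fun _ => a
  | csR, csM => fun _ => b
  | csL, csR | csM, csL | csM, csR | csR, csL => fun e => match e with end
  end.

Definition cospan_functor : functor cospan C.
Proof.
  refine (@Functor cospan C cospan_fob cospan_fmap _ _).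
  - intros []; reflexivity.
  - intros i j k v u.
    destruct i, j, k; simpl in *; try contradiction;
      rewrite ?comp1m, ?compm1; reflexivity.
Defined.

Definition pb_limit : limit cospan_functor := fc_lim cospan_finite cospan_functor.

Definition pb : C := lim_ob pb_limit.
Definition pb0 : hom pb A := lim_proj pb_limit csL.
Definition pb1 : hom pb B := lim_proj pb_limit csR.

Lemma pb_sq : a ∘ pb0 = b ∘ pb1.
Proof.
  transitivity (lim_proj pb_limit csM).
  - exact (lim_cone pb_limit (tt : @hom cospan csL csM)).
  - symmetry; exact (lim_cone pb_limit (tt : @hom cospan csR csM)).
Qed.

Definition cospan_legs (W : C) (x : hom W A) (y : hom W B) (i : cospan) :
    hom W (cospan_functor i) :=
  match i return hom W (cospan_fob i) with
  | csL => x
  | csM => a ∘ x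
  | csR => y
  end.

Lemma cospan_legs_cone W (x : hom W A) (y : hom W B) :
  a ∘ x = b ∘ y -> is_cone (cospan_legs x y).
Proof.
  intros e i j u.
  destruct i, j; simpl in *; try contradiction; rewrite ?comp1m; auto.
Qed.

Definition pb_pair (W : C) (x : hom W A) (y : hom W B) (e : a ∘ x = b ∘ y) :
    hom W pb :=
  lim_med pb_limit (cospan_legs_cone e).

Lemma pb0_pair W (x : hom W A) (y : hom W B) (e : a ∘ x = b ∘ y) :
  pb0 ∘ pb_pair e = x.
Proof. exact (lim_medP pb_limit (cospan_legs_cone e) csL). Qed.

Lemma pb1_pair W (x : hom W A) (y : hom W B) (e : a ∘ x = b ∘ y) :
  pb1 ∘ pb_pair e = y.
Proof. exact (lim_medP pb_limit (cospan_legs_cone e) csR). Qed.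

Lemma pb_uniq W (u v : hom W pb) :
  pb0 ∘ u = pb0 ∘ v -> pb1 ∘ u = pb1 ∘ v -> u = v.
Proof.
  intros e0 e1. apply (lim_uniq (l := pb_limit)).
  assert (eM : lim_proj pb_limit csM = a ∘ pb0).
  { symmetry; exact (lim_cone pb_limit (tt : @hom cospan csL csM)). }
  intros [].
  - exact e0.
  - rewrite eM, <- !compA, e0; reflexivity.
  - exact e1.
Qed.

Lemma pb_is_pullback : is_pullback a b pb0 pb1.
Proof.
  split; [exact pb_sq|].
  intros W x y e. exists (pb_pair e). split.
  - split; [apply pb0_pair | apply pb1_pair].
  - intros v [e0 e1]. apply pb_uniq; rewrite ?pb0_pair, ?pb1_pair; auto.
Qed.

End Cospan.

End Pullback.

Arguments pb {C A B Z} a b.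
Arguments pb0 {C A B Z} a b.
Arguments pb1 {C A B Z} a b.

(* [⟨x, y⟩[e]] is the morphism [(x, y)] into a chosen pullback, [e] being the
   proof that the square commutes; by [pb_uniq] it does not depend on [e]. *)
Notation "⟨ x , y ⟩[ e ]" := (@pb_pair _ _ _ _ _ _ _ x y e)
  (at level 0, x at level 99, y at level 99, e at level 99,
   format "⟨ x ,  y ⟩[ e ]") : cat_scope.

Definition mor_class (C : category) := forall X Y : C, hom X Y -> Prop.

Definition lifts (C : category) (A B X Y : C) (l : hom A B) (r : hom X Y) : Prop :=
  forall (u : hom A X) (v : hom B Y), r ∘ u = v ∘ l ->
    exists d : hom B X, d ∘ l = u /\ r ∘ d = v.

Definition weak_factorization_system (C : category) (L R : mor_class C) : Prop :=
  (forall (X Y : C) (f : hom X Y),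
     exists (Z : C) (l : hom X Z) (r : hom Z Y), L _ _ l /\ R _ _ r /\ r ∘ l = f) /\
  (forall (A B : C) (l : hom A B),
     L _ _ l <-> forall (X Y : C) (r : hom X Y), R _ _ r -> lifts l r) /\
  (forall (X Y : C) (r : hom X Y),
     R _ _ r <-> forall (A B : C) (l : hom A B), L _ _ l -> lifts l r).

Definition stable_under_pullback_along (C : category) (L R : mor_class C) : Prop :=
  forall (A B Z P : C) (a : hom A Z) (b : hom B Z) (p : hom P A) (q : hom P B),
    is_pullback a b p q -> R _ _ a -> L _ _ b -> L _ _ p.

Definition type_theoretic_wfs (C : category) (L R : mor_class C) : Prop :=
  weak_factorization_system L R /\
  (forall T : C, is_terminal T -> forall (X : C) (f : hom X T), R _ _ f) /\
  stable_under_pullback_along L R.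

Record factorization (C : category) := Factorization {
  Phi : forall X Y : C, hom X Y -> C;
  lam : forall (X Y : C) (f : hom X Y), hom X (Phi f);
  rho : forall (X Y : C) (f : hom X Y), hom (Phi f) Y;
  rho_lam : forall (X Y : C) (f : hom X Y), rho f ∘ lam f = f;
  Phi_sq : forall (X Y X' Y' : C) (f : hom X Y) (g : hom X' Y')
    (alpha : hom X X') (beta : hom Y Y'),
    g ∘ alpha = beta ∘ f -> hom (Phi f) (Phi g);
  Phi_sq_lam : forall (X Y X' Y' : C) (f : hom X Y) (g : hom X' Y')
    (alpha : hom X X') (beta : hom Y Y') (e : g ∘ alpha = beta ∘ f),
    Phi_sq e ∘ lam f = lam g ∘ alpha;
  rho_Phi_sq : forall (X Y X' Y' : C) (f : hom X Y) (g : hom X' Y')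
    (alpha : hom X X') (beta : hom Y Y') (e : g ∘ alpha = beta ∘ f),
    rho g ∘ Phi_sq e = beta ∘ rho f
}.

Definition coalg (C : category) (F : factorization C) : mor_class C :=
  fun X Y f => exists s : hom Y (Phi F f), s ∘ f = lam F f /\ rho F f ∘ s = idm Y.

Definition alg (C : category) (F : factorization C) : mor_class C :=
  fun X Y f => exists s : hom (Phi F f) X, s ∘ lam F f = idm X /\ f ∘ s = rho F f.

Definition weak_factorization_structure (C : category) (F : factorization C) : Prop :=
  forall (X Y : C) (f : hom X Y), coalg F (lam F f) /\ alg F (rho F f).

Definition type_theoretic (C : category) (F : factorization C) : Prop :=
  type_theoretic_wfs (coalg F) (alg F).

Record relation_on (C : category) := RelationOn {
  Psi : C -> C;
  eta : forall X : C, hom X (Psi X);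
  eps0 : forall X : C, hom (Psi X) X;
  eps1 : forall X : C, hom (Psi X) X;
  eps0_eta : forall X : C, eps0 X ∘ eta X = idm X;
  eps1_eta : forall X : C, eps1 X ∘ eta X = idm X;
  Psi_map : forall X Y : C, hom X Y -> hom (Psi X) (Psi Y);
  eps0_Psi : forall (X Y : C) (f : hom X Y), eps0 Y ∘ Psi_map f = f ∘ eps0 X;
  eps1_Psi : forall (X Y : C) (f : hom X Y), eps1 Y ∘ Psi_map f = f ∘ eps1 X;
  Psi_eta : forall (X Y : C) (f : hom X Y), Psi_map f ∘ eta X = eta Y ∘ f
}.

Section FactorizationOfRelation.

Variables (C : fc_category) (R : relation_on C).

Lemma FR_lam_sq (X Y : C) (f : hom X Y) : f ∘ idm X = eps0 R Y ∘ (eta R Y ∘ f).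
Proof. rewrite compA, eps0_eta, comp1m, compm1; reflexivity. Qed.

Definition FR_Phi (X Y : C) (f : hom X Y) : C := pb f (eps0 R Y).

Definition FR_lam (X Y : C) (f : hom X Y) : hom X (FR_Phi f) :=
  ⟨idm X, eta R Y ∘ f⟩[FR_lam_sq f].

Definition FR_rho (X Y : C) (f : hom X Y) : hom (FR_Phi f) Y :=
  eps1 R Y ∘ pb1 f (eps0 R Y).

Lemma FR_Phi_sq_sq (X Y X' Y' : C) (f : hom X Y) (g : hom X' Y')
    (alpha : hom X X') (beta : hom Y Y') : g ∘ alpha = beta ∘ f ->
  g ∘ (alpha ∘ pb0 f (eps0 R Y)) =
  eps0 R Y' ∘ (Psi_map R beta ∘ pb1 f (eps0 R Y)).
Proof.
  intros e. rewrite !compA, e, eps0_Psi, <- !compA, pb_sq; reflexivity.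
Qed.

Definition FR_Phi_sq (X Y X' Y' : C) (f : hom X Y) (g : hom X' Y')
    (alpha : hom X X') (beta : hom Y Y') (e : g ∘ alpha = beta ∘ f) :
    hom (FR_Phi f) (FR_Phi g) :=
  ⟨alpha ∘ pb0 f (eps0 R Y), Psi_map R beta ∘ pb1 f (eps0 R Y)⟩[FR_Phi_sq_sq e].

Lemma FR_rho_lam (X Y : C) (f : hom X Y) : FR_rho f ∘ FR_lam f = f.
Proof.
  unfold FR_rho, FR_lam, FR_Phi. rewrite <- compA, pb1_pair, compA, eps1_eta, comp1m.
  reflexivity.
Qed.

Lemma FR_Phi_sq_lam (X Y X' Y' : C) (f : hom X Y) (g : hom X' Y')
    (alpha : hom X X') (beta : hom Y Y') (e : g ∘ alpha = beta ∘ f) :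
  FR_Phi_sq e ∘ FR_lam f = FR_lam g ∘ alpha.
Proof.
  unfold FR_Phi_sq, FR_lam, FR_Phi. apply pb_uniq; rewrite !compA.
  - rewrite !pb0_pair, comp1m, <- compA, pb0_pair, compm1; reflexivity.
  - rewrite !pb1_pair, <- (compA (Psi_map R beta)), pb1_pair, compA, Psi_eta.
    rewrite <- !compA, e; reflexivity.
Qed.

Lemma FR_rho_Phi_sq (X Y X' Y' : C) (f : hom X Y) (g : hom X' Y')
    (alpha : hom X X') (beta : hom Y Y') (e : g ∘ alpha = beta ∘ f) :
  FR_rho g ∘ FR_Phi_sq e = beta ∘ FR_rho f.
Proof.
  unfold FR_rho, FR_Phi_sq, FR_Phi. rewrite <- compA, pb1_pair, !compA, eps1_Psi.
  reflexivity.
Qed.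

Definition F_of_relation : factorization C :=
  Factorization FR_rho_lam FR_Phi_sq_lam FR_rho_Phi_sq.

End FactorizationOfRelation.

Section Moore.

Variables (C : fc_category) (R : relation_on C).

Local Notation Ψ := (Psi R).
Local Notation η := (eta R).
Local Notation ε0 := (eps0 R).
Local Notation ε1 := (eps1 R).

Lemma transitive_sq (X : C) : ε1 X ∘ idm (Ψ X) = ε0 X ∘ (η X ∘ ε1 X).
Proof. rewrite compA, eps0_eta, comp1m, compm1; reflexivity. Qed.

Definition transitive : Prop :=
  forall X : C, exists mu : hom (pb (ε1 X) (ε0 X)) (Ψ X),
    ε0 X ∘ mu = ε0 X ∘ pb0 (ε1 X) (ε0 X) /\
    ε1 X ∘ mu = ε1 X ∘ pb1 (ε1 X) (ε0 X) /\
    mu ∘ ⟨idm (Ψ X), η X ∘ ε1 X⟩[transitive_sq X] = idm (Ψ X).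

Lemma symmetric_sq (X : C) : ε0 X ∘ (η X ∘ ε0 X) = ε0 X ∘ idm (Ψ X).
Proof. rewrite compA, eps0_eta, comp1m, compm1; reflexivity. Qed.

Definition symmetric : Prop :=
  forall X : C, exists nu : hom (pb (ε0 X) (ε0 X)) (Ψ X),
    ε0 X ∘ nu = ε1 X ∘ pb0 (ε0 X) (ε0 X) /\
    ε1 X ∘ nu = ε1 X ∘ pb1 (ε0 X) (ε0 X) /\
    nu ∘ ⟨η X ∘ ε0 X, idm (Ψ X)⟩[symmetric_sq X] = idm (Ψ X).

(* The suffix [S] stands for the superscript square: [PsiS] is [Ψ□ Y], etc. *)
Record square_data (Y : C) := SquareData {
  PsiS : C;
  etaS : hom Y PsiS;
  epsS0 : hom PsiS (Ψ Y);
  epsS1 : hom PsiS (Ψ Y);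
  zeta : hom PsiS (Ψ Y);
  delta : hom (Ψ Y) PsiS;
  epsS0_etaS : epsS0 ∘ etaS = η Y;
  epsS1_etaS : epsS1 ∘ etaS = η Y;
  zeta_etaS : zeta ∘ etaS = η Y;
  eps0_epsS0 : ε0 Y ∘ epsS0 = ε0 Y ∘ zeta;
  eps0_epsS1 : ε0 Y ∘ epsS1 = ε1 Y ∘ zeta;
  delta_eta : delta ∘ η Y = etaS;
  epsS0_delta : epsS0 ∘ delta = η Y ∘ ε0 Y;
  zeta_delta : zeta ∘ delta = η Y ∘ ε0 Y;
  epsS1_delta : epsS1 ∘ delta = idm (Ψ Y)
}.

Section Tau.

Variables (Y : C) (S : square_data Y) (X : C) (f : hom X Y).

Lemma tau_dom_sq : (η Y ∘ f) ∘ idm X = zeta S ∘ (etaS S ∘ f).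
Proof. rewrite compm1, compA, zeta_etaS; reflexivity. Qed.

Lemma tau_eps0_sq :
  f ∘ pb0 (η Y ∘ f) (zeta S) = ε0 Y ∘ (epsS0 S ∘ pb1 (η Y ∘ f) (zeta S)).
Proof.
  rewrite compA, eps0_epsS0, <- compA, <- pb_sq, !compA, eps0_eta, comp1m.
  reflexivity.
Qed.

Lemma tau_eps1_sq :
  f ∘ pb0 (η Y ∘ f) (zeta S) = ε0 Y ∘ (epsS1 S ∘ pb1 (η Y ∘ f) (zeta S)).
Proof.
  rewrite compA, eps0_epsS1, <- compA, <- pb_sq, !compA, eps1_eta, comp1m.
  reflexivity.
Qed.

Definition is_tau
    (tau : hom (pb (η Y ∘ f) (zeta S)) (Ψ (pb f (ε0 Y)))) : Prop :=
  tau ∘ ⟨idm X, etaS S ∘ f⟩[tau_dom_sq]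
    = η (pb f (ε0 Y)) ∘ ⟨idm X, η Y ∘ f⟩[FR_lam_sq R f] /\
  ε0 (pb f (ε0 Y)) ∘ tau
    = ⟨pb0 (η Y ∘ f) (zeta S), epsS0 S ∘ pb1 (η Y ∘ f) (zeta S)⟩[tau_eps0_sq] /\
  ε1 (pb f (ε0 Y)) ∘ tau
    = ⟨pb0 (η Y ∘ f) (zeta S), epsS1 S ∘ pb1 (η Y ∘ f) (zeta S)⟩[tau_eps1_sq].

End Tau.

(* [τ_f] only involves the square data at the codomain of [f], so the data may
   be chosen object by object. *)
Definition homotopical : Prop :=
  forall Y : C, exists S : square_data Y,
    forall (X : C) (f : hom X Y), exists tau : hom (pb (η Y ∘ f) (zeta S)) (Ψ (pb f (ε0 Y))), is_tau tau.

Definition moore_relation_system : Prop :=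
  transitive /\ homotopical /\ symmetric.

End Moore.

(* Main.v *)
(** A morphism [f] is an [F(R)]-coalgebra iff it is a strong deformation retract:
    it has a retraction [r] and a homotopy [h] from [f r] to [1] that is constant on [f].
    An [F(R)]-algebra structure on [a : A -> Z] transports points of [A] along
    paths of [Z].  The morphism [τ] provides a homotopy from [λ π0] to [1] on the
    mapping path object, whence [λ f] is a coalgebra; [μ] concatenates paths,
    whence [ρ f] is an algebra.
    For stability, let [(r, h)] be a deformation for [b], let [s] be a transport
    for [a], and let [p] be the pullback of [b] along [a].  The inverse path of [h] moves
    [a x] to [b (r (a x))]; transporting [x] along it lands in the pullback, and
    the image under [Ψ s] of the canonical homotopy on the mapping path object of
    [a], once inverted, is the required deformation. *)

Require Import Defs.

Set Implicit Arguments.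
Unset Strict Implicit.
Unset Printing Implicit Defensive.

Lemma comp_reassoc (C : category) (X Y Z : C) (g : hom Y Z) (f : hom X Y)
    (k : hom X Z) :
  g ∘ f = k -> forall W (u : hom W X), g ∘ (f ∘ u) = k ∘ u.
Proof. intros e W u. rewrite compA, e. reflexivity. Qed.

(** The lift runs through both factorizations: the coalgebra structure [s] of [l], then [Phi_sq] of
    the square, then the algebra structure [t] of [r]. *)
Lemma coalg_alg_lifts (C : category) (F : factorization C) (A B X Y : C)
    (l : hom A B) (r : hom X Y) :
  coalg F l -> alg F r -> lifts l r.
Proof.
  intros (s & sl & rs) (t & tl & rt) u v e.
  exists (t ∘ (Phi_sq F e ∘ s)). split.
  - rewrite <- !compA, sl, Phi_sq_lam, compA, tl, comp1m. reflexivity.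
  - rewrite compA, rt, compA, rho_Phi_sq, <- compA, rs, compm1. reflexivity.
Qed.

Lemma weak_factorization_structure_wfs (C : category) (F : factorization C) :
  weak_factorization_structure F -> weak_factorization_system (coalg F) (alg F).
Proof.
  intros HF. split; [|split].
  - intros X Y f. exists (Phi F f), (lam F f), (rho F f).
    destruct (HF X Y f). repeat split; trivial. apply rho_lam.
  - intros A B l. split.
    + intros Hl X Y r Hr. apply (coalg_alg_lifts (F := F)); assumption.
    + intros Hl.
      (* A filler of the square with top [lam F l] and bottom the identity is exactly a coalgebra
         structure on [l]. *)
      destruct (Hl _ _ (rho F l) (proj2 (HF _ _ l)) (lam F l) (idm B)) as (d & d1 & d2).
      * rewrite (rho_lam F), comp1m. reflexivity.
      * exists d. auto.
  - intros X Y r. split.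
    + intros Hr A B l Hl. apply (coalg_alg_lifts (F := F)); assumption.
    + intros Hr.
      destruct (Hr _ _ (lam F r) (proj1 (HF _ _ r)) (idm X) (rho F r)) as (d & d1 & d2).
      * rewrite (rho_lam F), compm1. reflexivity.
      * exists d. auto.
Qed.

Section Relation.

Variables (C : fc_category) (R : relation_on C).

Local Notation Ψ := (Psi R).
Local Notation η := (eta R).
Local Notation ε0 := (eps0 R).
Local Notation ε1 := (eps1 R).
Local Notation F := (F_of_relation R).

Lemma coalg_FRP (X Y : C) (f : hom X Y) :
  coalg F f <->
  exists (r : hom Y X) (h : hom Y (Ψ Y)),
    r ∘ f = idm X /\ h ∘ f = η Y ∘ f /\ ε0 Y ∘ h = f ∘ r /\ ε1 Y ∘ h = idm Y.
Proof.
  split.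
  - intros (s & sf & rs). simpl in s, sf, rs.
    exists (pb0 f (ε0 Y) ∘ s), (pb1 f (ε0 Y) ∘ s).
    unfold FR_lam, FR_rho, FR_Phi in *. split; [|split; [|split]].
    + rewrite <- compA, sf. apply pb0_pair.
    + rewrite <- compA, sf. apply pb1_pair.
    + rewrite !compA, pb_sq. reflexivity.
    + rewrite compA. exact rs.
  - intros (r & h & rf & hf & e0 & e1).
    exists ⟨r, h⟩[eq_sym e0]. simpl. unfold FR_lam, FR_rho, FR_Phi. split.
    + apply pb_uniq; rewrite compA; [rewrite !pb0_pair | rewrite !pb1_pair]; assumption.
    + rewrite <- compA, pb1_pair. exact e1.
Qed.

(** Over a terminal object the equation with [rho] is automatic, so the projection to [X] is an
    algebra structure. *)
Lemma alg_FR_terminal (X T : C) (f : hom X T) : is_terminal T -> alg F f.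
Proof.
  intros HT. exists (pb0 f (ε0 T)). split.
  - apply pb0_pair.
  - destruct (HT (Phi F f)) as (t & _ & Ht).
    transitivity t; [symmetry|]; apply Ht; exact I.
Qed.

Lemma symmetric_inverse :
  symmetric R -> forall X : C, exists iota : hom (Ψ X) (Ψ X),
    ε0 X ∘ iota = ε1 X /\ ε1 X ∘ iota = ε0 X /\ iota ∘ η X = η X.
Proof.
  intros HS X. destruct (HS X) as (nu & nu0 & nu1 & nuu).
  assert (e : ε0 X ∘ idm (Ψ X) = ε0 X ∘ (η X ∘ ε0 X)).
  { rewrite compA, eps0_eta, comp1m, compm1. reflexivity. }
  (* [nu] joins the targets of two paths with a common source; taking the second path constant
     reverses the first. *)
  exists (nu ∘ ⟨idm (Ψ X), η X ∘ ε0 X⟩[e]). split; [|split].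
  - rewrite compA, nu0, <- compA, pb0_pair, compm1. reflexivity.
  - rewrite compA, nu1, <- compA, pb1_pair, compA, eps1_eta, comp1m. reflexivity.
  (* On a constant path both arguments of [nu] are constant, so the unit law applies although its
     constant argument is the first one. *)
  - transitivity (nu ∘ ⟨η X ∘ ε0 X, idm (Ψ X)⟩[symmetric_sq R X] ∘ η X).
    + rewrite <- !compA. f_equal. apply pb_uniq; rewrite !compA.
      * rewrite !pb0_pair, <- compA, eps0_eta, comp1m, compm1. reflexivity.
      * rewrite !pb1_pair, <- compA, eps0_eta, comp1m, compm1. reflexivity.
    + rewrite nuu, comp1m. reflexivity.
Qed.

Lemma homotopical_lam_deformation :
  homotopical R -> forall (X Y : C) (f : hom X Y),
  exists H : hom (FR_Phi R f) (Ψ (FR_Phi R f)),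
    ε0 _ ∘ H = FR_lam R f ∘ pb0 f (ε0 Y) /\ ε1 _ ∘ H = idm _ /\
    H ∘ FR_lam R f = η _ ∘ FR_lam R f.
Proof.
  intros HH X Y f. destruct (HH Y) as (S & HS). destruct (HS X f) as (tau & t & t0 & t1).
  unfold FR_Phi, FR_lam.
  (* [delta] turns a path into a square from the constant path at its source to the path itself; its
     [zeta] side is constant, as the domain of [tau] demands. *)
  assert (e : (η Y ∘ f) ∘ pb0 f (ε0 Y) = zeta S ∘ (delta S ∘ pb1 f (ε0 Y))).
  { rewrite compA, zeta_delta, <- !compA, pb_sq. reflexivity. }
  exists (tau ∘ ⟨pb0 f (ε0 Y), delta S ∘ pb1 f (ε0 Y)⟩[e]). split; [|split].
  - rewrite compA, t0. apply pb_uniq; rewrite !compA.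
    + rewrite !pb0_pair, comp1m. reflexivity.
    + rewrite !pb1_pair, <- !compA, pb1_pair, compA, epsS0_delta, <- compA, pb_sq.
      reflexivity.
  - rewrite compA, t1. apply pb_uniq; rewrite !compA, compm1.
    + rewrite !pb0_pair. reflexivity.
    + rewrite !pb1_pair, <- !compA, pb1_pair, compA, epsS1_delta, comp1m. reflexivity.
  - rewrite <- t, <- compA. f_equal. apply pb_uniq; rewrite !compA.
    + rewrite !pb0_pair. reflexivity.
    + rewrite !pb1_pair, <- !compA, pb1_pair, compA, delta_eta. reflexivity.
Qed.

Lemma homotopical_coalg_lam :
  homotopical R -> forall (X Y : C) (f : hom X Y), coalg F (lam F f).
Proof.
  intros HH X Y f. destruct (homotopical_lam_deformation HH f) as (H & H0 & H1 & Hl).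
  apply coalg_FRP. exists (pb0 f (ε0 Y)), H. repeat split; trivial. apply pb0_pair.
Qed.

Lemma transitive_alg_rho :
  transitive R -> forall (X Y : C) (f : hom X Y), alg F (rho F f).
Proof.
  intros HT X Y f. destruct (HT Y) as (mu & mu0 & mu1 & muu).
  unfold alg. simpl. unfold FR_lam, FR_rho, FR_Phi.
  set (x := pb0 f (ε0 Y)). set (y := pb1 f (ε0 Y)).
  set (w := pb0 (ε1 Y ∘ y) (ε0 Y)). set (z := pb1 (ε1 Y ∘ y) (ε0 Y)).
  assert (e : ε1 Y ∘ (y ∘ w) = ε0 Y ∘ z).
  { rewrite compA. apply pb_sq. }
  assert (e' : f ∘ (x ∘ w) = ε0 Y ∘ (mu ∘ ⟨y ∘ w, z⟩[e])).
  { rewrite !compA, mu0, <- !compA, pb0_pair, !compA. unfold x, y. rewrite pb_sq.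
    reflexivity. }
  (* Transport along [z] keeps the point of [X] and appends [z] to the path. *)
  exists ⟨x ∘ w, mu ∘ ⟨y ∘ w, z⟩[e]⟩[e']. split.
  - apply pb_uniq; rewrite !compA, compm1.
    + rewrite pb0_pair, <- compA. unfold w. rewrite pb0_pair, compm1. reflexivity.
    + rewrite pb1_pair.
      transitivity (mu ∘ ⟨idm (Ψ Y), η Y ∘ ε1 Y⟩[transitive_sq R Y] ∘ y).
      * rewrite <- !compA. f_equal. apply pb_uniq; rewrite !compA.
        -- rewrite !pb0_pair, <- compA. unfold w. rewrite pb0_pair, comp1m, compm1.
           reflexivity.
        -- rewrite !pb1_pair. apply compA.
      * rewrite muu, comp1m. reflexivity.
  - rewrite <- compA. unfold y at 1. rewrite pb1_pair, compA, mu1, <- compA, pb1_pair.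
    reflexivity.
Qed.

Lemma coalg_FR_stable :
  homotopical R -> symmetric R -> stable_under_pullback_along (coalg F) (alg F).
Proof.
  intros HH HS A B Z P a b p q [sq univ] Ha Hb.
  destruct Ha as (s & sl & sr).
  apply coalg_FRP in Hb. destruct Hb as (r & h & rb & hb & h0 & h1).
  destruct (symmetric_inverse HS Z) as (iZ & iZ0 & iZ1 & iZe).
  destruct (symmetric_inverse HS A) as (iA & iA0 & iA1 & iAe).
  destruct (homotopical_lam_deformation HH a) as (H & H0 & H1 & Hl).
  simpl in s, sl, sr.
  assert (e : a ∘ idm A = ε0 Z ∘ (iZ ∘ h ∘ a)).
  { rewrite !compA, iZ0, h1, comp1m, compm1. reflexivity. }
  set (g := ⟨idm A, iZ ∘ h ∘ a⟩[e] : hom A (FR_Phi R a)).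
  (* Since [a ∘ p = b ∘ q] and [h] is constant on [b], the reversed path is constant over [P]. *)
  assert (gp : g ∘ p = FR_lam R a ∘ p).
  { unfold g, FR_lam, FR_Phi. apply pb_uniq; rewrite !compA.
    - rewrite !pb0_pair. reflexivity.
    - rewrite !pb1_pair, <- !compA, sq, (comp_reassoc hb), <- compA,
        (comp_reassoc iZe). reflexivity. }
  assert (g0 : pb0 a (ε0 Z) ∘ g = idm A) by apply pb0_pair.
  assert (sg : a ∘ (s ∘ g) = b ∘ (r ∘ a)).
  { rewrite compA, sr. unfold FR_rho, g, FR_Phi.
    rewrite <- compA, pb1_pair, !compA, iZ1, h0. reflexivity. }
  destruct (univ A _ _ sg) as (r' & (r'p & r'q) & _).
  apply coalg_FRP.
  (* Before [iA], the homotopy runs from [s ∘ λ ∘ π0 ∘ g = 1] to [s ∘ g = p ∘ r']. *)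
  exists r', (iA ∘ Psi_map R s ∘ H ∘ g). split; [|split; [|split]].
  - destruct (univ P p q sq) as (i & _ & iu).
    transitivity i; [symmetry|]; apply iu; split; rewrite ?compm1; trivial.
    + rewrite compA, r'p, <- compA, gp, compA, sl, comp1m. reflexivity.
    + rewrite compA, r'q, <- compA, sq, compA, rb, comp1m. reflexivity.
  - rewrite <- !compA, gp, (comp_reassoc Hl), <- compA, (comp_reassoc (Psi_eta R s)).
    rewrite <- compA, (comp_reassoc sl), comp1m, compA, iAe. reflexivity.
  - rewrite !compA, iA0, eps1_Psi, <- (compA s), H1, compm1, r'p. reflexivity.
  - rewrite !compA, iA1, eps0_Psi, <- (compA s), H0, compA, sl, comp1m. exact g0.
Qed.

End Relation.

Theorem theorem3p33 (C : fc_category) (R : relation_on C)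
    (HR : moore_relation_system R) :
  weak_factorization_structure (F_of_relation R) /\
  type_theoretic (F_of_relation R).
Proof.
  destruct HR as (HT & HH & HS).
  assert (HF : weak_factorization_structure (F_of_relation R)).
  { intros X Y f. split; [apply homotopical_coalg_lam | apply transitive_alg_rho]; trivial. }
  split; [exact HF|]. split; [|split].
  - apply weak_factorization_structure_wfs. exact HF.
  - intros T t X f. apply alg_FR_terminal. exact t.
  - apply coalg_FR_stable; assumption.
Qed.
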